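(* Let $G,\Omega,\Sigma=\{\Delta_1,\dots,\Delta_s\},\Delta=\Delta_1,L,M,R,M_i,\rho_{i,j},B_A$ be as in the context. Let $X:=G^{(2),\Omega}$ and let $Y:=X_\Delta^\Delta$ be the permutation group induced on $\Delta$ by the setwise stabiliser $X_\Delta$. Suppose that $G\ne X$ but $L=L^{(2),\Sigma}$. Then the following hold. (a) $X\le Y\wr L=B_Y\rtimes L$, and $R\le Y\le R^{(2),\Delta}$. (b) $X=N\rtimes G$, where $N=B_Y\cap X>1$, and $N$ consists precisely of all the elements $(y_1,\dots,y_s)\in B_Y$ such that $$(y_i,y_j)\in(\rho_{i,j}(M_i\cap M_j))^{(1),\Delta_i\times\Delta_j}\quad\text{for all }1\le i<j\le s.$$ (c) If $p:=|R|$ is prime then $Y=R^{(2),\Delta}=R=C_p$ and, for $2\le j\le s$, $$(\rho_{1,j}(M\cap M_j))^{\Delta_1\times\Delta_j}=(Y\times Y)\cap(\rho_{1,j}(M\cap M_j))^{(1),\Delta_1\times\Delta_j}$$ is equal to either $Y\times Y$ or a diagonal subgroup of $Y\times Y$. In particular, there exists $(y_1,\dots,y_s)\in N$ with both $y_1$ and $y_j$ nontrivial.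
   Context: For $P\le\mathrm{Sym}(\Gamma)$, $P^{(2),\Gamma}$ denotes the $2$-closure: all $g\in\mathrm{Sym}(\Gamma)$ leaving invariant each $P$-orbit on $\Gamma\times\Gamma$; $P^{(1),\Gamma}$ denotes the $1$-closure: the largest subgroup of $\mathrm{Sym}(\Gamma)$ with the same orbits on $\Gamma$ as $P$. If $P$ acts on $\Gamma$, $P^\Gamma$ is the induced permutation group. Setting. $G$ is a finite group acting faithfully, transitively and imprimitively on a finite set $\Omega$ (so $G\le\mathrm{Sym}(\Omega)$); $\Sigma=\{\Delta_1,\dots,\Delta_s\}$ is a nontrivial $G$-invariant partition of $\Omega$, $1<s<|\Omega|$; $L=G^\Sigma\le\mathrm{Sym}(\Sigma)$; $\Delta=\Delta_1$; $M=G_\Delta$ is the setwise stabiliser of $\Delta$; $R=M^\Delta\le\mathrm{Sym}(\Delta)$. It is assumed that $M$ is core-free in $G$ (equivalently $G$ acts faithfully on $\Sigma$, so $G\cong L$). By the imprimitive wreath embedding theorem, identify $\Sigma$ with $\{1,\dots,s\}$, $\Omega$ with $\Delta\times\{1,\dots,s\}$ and $\Delta_i$ with $\Delta\times\{i\}$ so that $G\le R\wr L=B_R\rtimes L$, where $B_R=R^s$, and $(x_1,\dots,x_s)\in B_R$ and $\sigma\in L$ act by $(\delta,i)^{(x_1,\dots,x_s)}=(\delta^{x_i},i)$ and $(\delta,i)^\sigma=(\delta,i^\sigma)$. For any $A\le\mathrm{Sym}(\Delta)$, $B_A=A^s$ denotes the naturally embedded base group in $\mathrm{Sym}(\Delta)\wr\mathrm{Sym}(s)$.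 For each $i$, $M_i$ is the setwise stabiliser of $\Delta_i$ in $G$ (so $M_1=M$). For distinct $i,j$, each element of $\mathrm{Sym}(\Delta)\wr L$ fixing $\Delta_i$ and $\Delta_j$ setwise has the form $(x_1,\dots,x_s)\sigma$ with $\sigma\in L$ fixing $i$ and $j$, and $\rho_{i,j}$ is the homomorphism $(x_1,\dots,x_s)\sigma\mapsto(x_i,x_j)\in\mathrm{Sym}(\Delta)\times\mathrm{Sym}(\Delta)$. Pairs $(x_i,x_j)$ act faithfully on $\Delta_i\times\Delta_j$ in product action $(\delta_i,\delta_j)^{(x_i,x_j)}=(\delta_i^{x_i},\delta_j^{x_j})$, and $1$-closures on $\Delta_i\times\Delta_j$ are taken with respect to this action. A diagonal subgroup of $E\times E$ is a subgroup of the form $\{(e,e^\theta): e\in F\}$ with $F\le E$ and $\theta\in\mathrm{Aut}(F)$. *)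

(* Defs.v *)
From HB Require Import structures.
From mathcomp Require Import all_boot all_fingroup all_solvable.

Set Implicit Arguments.
Unset Strict Implicit.
Unset Printing Implicit Defensive.

Local Open Scope group_scope.

Section ProductAction.
Variable T : finType.

Definition prod_fun (u : {perm T} * {perm T}) (p : T * T) := (u.1 p.1, u.2 p.2).

Lemma prod_fun_inj u : injective (prod_fun u).
Proof. by move=> [a b] [c d] [/perm_inj -> /perm_inj ->]. Qed.

Definition prod_perm u : {perm T * T} := perm (@prod_fun_inj u).

Lemma prod_permE u p : prod_perm u p = (u.1 p.1, u.2 p.2).
Proof. by rewrite permE. Qed.

Definition pair_act (p : T * T) (g : {perm T}) := prod_perm (g, g) p.

Lemma pair_act1 p : pair_act p 1 = p.
Proof. by rewrite /pair_act prod_permE /= !perm1 -surjective_pairing. Qed.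

Lemma pair_actM p g h : pair_act p (g * h) = pair_act (pair_act p g) h.
Proof. by rewrite /pair_act !prod_permE /= !permM. Qed.

Canonical pair_action := TotalAction pair_act1 pair_actM.

End ProductAction.

Section Closures.
Variable T : finType.
Implicit Types (P : {set {perm T}}) (Q : {group {perm T}}).

Definition closure2 P : {set {perm T}} :=
  \bigcap_(O in orbit (@pair_action T) P @: setT) 'N(O | @pair_action T).

Canonical closure2_group P := [group of closure2 P].

Definition orbits P : {set {set T}} := orbit 'P P @: setT.

(* The join of all groups with the same orbits as [P]; when [P] is a group
   [orbits_closure1] and [closure1_max] say that it is the largest of them. *)
Definition closure1 P : {set {perm T}} :=
  <<\bigcup_(Q : {group {perm T}} | orbits Q == orbits P) Q>>.

Canonical closure1_group P := [group of closure1 P].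

Lemma closure1_max P Q : orbits Q = orbits P -> Q \subset closure1 P.
Proof. by move=> eqQP; apply/sub_gen/bigcup_sup; rewrite eqQP. Qed.

Lemma orbits_orbit (H K : {group {perm T}}) x :
  orbits H = orbits K -> orbit 'P H x = orbit 'P K x.
Proof.
move=> eqHK; have /imsetP[y _ Ey]: orbit 'P H x \in orbits K.
  by rewrite -eqHK imset_f.
have: x \in orbit 'P H x by apply: orbit_refl.
by rewrite Ey => /orbit_in_eqP ->; rewrite ?subsetT.
Qed.

Lemma orbits_closure1 (P : {group {perm T}}) : orbits (closure1 P) = orbits P.
Proof.
apply: eq_imset => x; apply/setP/subset_eqP/andP; split; last first.
  by apply/imsetS/closure1_max.
have sub: closure1 P \subset 'N(orbit 'P P x | 'P).
  rewrite gen_subG; apply/bigcupsP=> Q /eqP eqQP.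
  by rewrite -(orbits_orbit x eqQP) acts_orbit ?subsetT.
apply/subsetP=> _ /imsetP[g /(subsetP sub) gN ->].
by rewrite (astabs_act _ gN) orbit_refl.
Qed.

End Closures.

Section Wreath.
Variables (D : finType) (s : nat).

Notation Omega := (D * 'I_s)%type.

Definition block i : {set Omega} := [set x | x.2 == i].
Definition blocks : {set {set Omega}} := [set block i | i : 'I_s].

Definition base_fun (x : {ffun 'I_s -> {perm D}}) (w : Omega) := (x w.2 w.1, w.2).

Lemma base_fun_inj x : injective (base_fun x).
Proof. by move=> [d i] [e j] [/= + eq_ij]; rewrite eq_ij => /perm_inj ->. Qed.

Definition base_perm x : {perm Omega} := perm (@base_fun_inj x).

Definition top_fun (sigma : {perm 'I_s}) (w : Omega) := (w.1, sigma w.2).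

Lemma top_fun_inj sigma : injective (top_fun sigma).
Proof. by move=> [d i] [e j] [/= -> /perm_inj ->]. Qed.

Definition top_perm sigma : {perm Omega} := perm (@top_fun_inj sigma).

Definition base (A : {set {perm D}}) : {set {perm Omega}} :=
  [set base_perm x | x : {ffun 'I_s -> {perm D}} & [forall i, x i \in A]].

Definition top (K : {set {perm 'I_s}}) : {set {perm Omega}} :=
  [set top_perm sigma | sigma in K].

Definition wreath A K : {set {perm Omega}} := base A * top K.

Lemma wreath_permE x sigma w :
  (base_perm x * top_perm sigma) w = (x w.2 w.1, sigma w.2).
Proof. by rewrite permM !permE. Qed.

(* The tuple (x_1, ..., x_s) of an element (x_1, ..., x_s) sigma, see
   [wr_coordE]; the value is junk outside the full wreath product. *)
Definition wr_coord (g : {perm Omega}) : {ffun 'I_s -> {perm D}} :=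
  odflt [ffun=> 1]
    [pick x | [exists sigma, g == base_perm x * top_perm sigma]].

Lemma wr_coordE x sigma : wr_coord (base_perm x * top_perm sigma) = x.
Proof.
rewrite /wr_coord; case: pickP => [y /existsP[tau /eqP eq_xy] | /(_ x)] /=; last first.
  by move/existsP; case; exists sigma.
apply/ffunP=> i; apply/permP=> d.
by have := congr1 (fun g : {perm Omega} => (g (d, i)).1) eq_xy; rewrite !wreath_permE.
Qed.

Definition rho i j (g : {perm Omega}) : {perm D} * {perm D} :=
  (wr_coord g i, wr_coord g j).

Definition block_stab (H : {set {perm Omega}}) i : {set {perm Omega}} :=
  'N_H(block i | 'P).

(* The permutation group induced on [block i] by the setwise stabiliser of
   [block i] in [H], transported to [D] along [d |-> (d, i)]. *)
Definition induced_on_block (H : {set {perm Omega}}) i : {set {perm D}} :=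
  [set r : {perm D} | [exists h in block_stab H i, [forall d, h (d, i) == (r d, i)]]].

(* The permutation group induced by [H] on the blocks, transported to ['I_s]
   along [block]. *)
Definition induced_on_blocks (H : {set {perm Omega}}) : {set {perm 'I_s}} :=
  [set sigma : {perm 'I_s} | [exists h in H,
     [forall i, h @: block i == block (sigma i)]]].

Canonical block_stab_group (H : {group {perm Omega}}) i :=
  [group of block_stab H i].

Lemma induced_on_block_group_set (H : {group {perm Omega}}) i :
  group_set (induced_on_block H i).
Proof.
apply/group_setP; split=> [|r t].
  by rewrite inE; apply/exists_inP; exists 1; rewrite ?group1 //; apply/forallP=> d; rewrite !perm1.
rewrite !inE => /exists_inP[g gH /forallP rg] /exists_inP[h hH /forallP th].
apply/exists_inP; exists (g * h); rewrite ?groupM //.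
by apply/forallP=> d; rewrite !permM (eqP (rg d)) (eqP (th _)).
Qed.
Canonical induced_on_block_group H i := group (induced_on_block_group_set H i).

Lemma induced_on_blocks_group_set (H : {group {perm Omega}}) :
  group_set (induced_on_blocks H).
Proof.
apply/group_setP; split=> [|r t].
  rewrite inE; apply/exists_inP; exists 1; rewrite ?group1 //; apply/forallP=> i.
  rewrite perm1; apply/eqP; rewrite -[RHS]imset_id.
  by apply: eq_imset => w; rewrite perm1.
rewrite !inE => /exists_inP[g gH /forallP rg] /exists_inP[h hH /forallP th].
apply/exists_inP; exists (g * h); rewrite ?groupM //; apply/forallP=> i.
rewrite permM -(eqP (th _)) -(eqP (rg _)) -imset_comp.
by apply/eqP/eq_imset => w; rewrite permM.
Qed.
Canonical induced_on_blocks_group H := group (induced_on_blocks_group_set H).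

End Wreath.

Definition diagonal_subgroup (gT : finGroupType) (E : {set gT})
    (Q : {set gT * gT}) : Prop :=
  exists F : {group gT}, F \subset E /\
    exists2 theta, theta \in Aut F & Q = [set (e, theta e) | e in F].

(* Main.v *)
Require Import Defs.
From HB Require Import structures.
From mathcomp Require Import all_boot all_fingroup all_solvable.

(** An element of [X] agrees on any two points with some element of [G], so
    [X] preserves the blocks and, as [L] is 2-closed, acts on them as [L] does.
    Dividing an element of [X] by an element of [G] with the same action on
    the blocks lands in [N], while core-freeness gives [N :&: G = 1].
    When [#|R|] is prime, [R] is regular on [D]; hence so is [R x R] on
    [D x D], and the 1-closure of a subgroup of [R x R] adds nothing inside
    [R x R].  In particular [(y i, y j)] lies in [rho i j (M i :&: M j)] for all
    [y] in [N].  Since [N] is nontrivial and normalised by the transitive [G],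
    it projects nontrivially to every coordinate, so [rho i j (M i :&: M j)] is
    a subgroup of [C_p x C_p] projecting onto both factors. *)

Set Implicit Arguments.
Unset Strict Implicit.
Unset Printing Implicit Defensive.

Local Open Scope group_scope.

(** * Pointwise criteria for the 1- and 2-closure *)

Section ClosureTheory.
Variable T : finType.
Implicit Types (H : {group {perm T}}) (g : {perm T}).

(** The orbit of [(a, b)] consists of the pairs [(h a, h b)], so preserving all orbits on pairs
    means imitating [H] on two points at a time. *)
Lemma closure2P H g :
  reflect (forall a b, exists2 h, h \in H & h a = g a /\ h b = g b)
          (g \in closure2 H).
Proof.
apply: (iffP bigcapP) => [gN a b | agree O /imsetP[[a b] _ ->]].
  have /(astabs_act (a, b)) :=
    gN (orbit (pair_action T) H (a, b)) (imset_f _ (in_setT _)).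
  rewrite orbit_refl => /orbitP[h hH]; rewrite /= /pair_act !prod_permE /=.
  by case=> ha hb; exists h.
rewrite !inE /=; apply/subsetP=> _ /orbitP[k kH <-]; rewrite inE.
have [h hH [ha hb]] := agree (k a) (k b).
apply/orbitP; exists (k * h); first exact: groupM.
by rewrite /= /pair_act !prod_permE /= !permM ha hb.
Qed.

Lemma sub_closure2 H : H \subset closure2 H.
Proof. by apply/subsetP=> g gH; apply/closure2P=> a b; exists g. Qed.

Lemma closure1P H g :
  reflect (forall x, g x \in orbit 'P H x) (g \in closure1 H).
Proof.
apply: (iffP idP) => [gH x | gH].
  rewrite -(orbits_orbit (H := closure1_group H) x (orbits_closure1 H)).
  exact: (mem_orbit 'P).
(* Adjoining [g] creates no new orbits, so the enlarged group is one of those joined in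
   [closure1 H]. *)
have eqO : orbits <<g |: H>> = orbits H.
  apply: eq_imset => x; apply/eqP; rewrite eqEsubset andbC.
  rewrite imsetS ?(subset_trans (subsetUr [set g] H)) ?subset_gen //=.
  suff /subsetP sN : <<g |: H>> \subset 'N(orbit 'P H x | 'P).
    by apply/subsetP=> _ /imsetP[h /sN hN ->]; rewrite (astabs_act _ hN) orbit_refl.
  rewrite gen_subG subUset sub1set acts_orbit ?subsetT // andbT !inE /=.
  apply/subsetP=> y xy; rewrite inE /=.
  by rewrite -(orbit_eqP xy) gH.
apply: (subsetP (closure1_max eqO)).
by rewrite mem_gen ?setU11.
Qed.

(** The stabiliser of [x] is trivial, so only one [h] agrees with [g] at [x]; interpolating at [x]
    and [y] shows that it also agrees at [y]. *)
Lemma closure2_free_point H x :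
  (forall h, h \in H -> h x = x -> h = 1) -> closure2 H = H.
Proof.
move=> freeH; apply/eqP; rewrite eqEsubset sub_closure2 andbT.
apply/subsetP=> g /closure2P agree; have [h hH [hx _]] := agree x x.
suff -> : g = h by [].
apply/permP=> y; have [k kH [kx <-]] := agree x y.
suff /eqP : k * h^-1 = 1 by rewrite -eq_mulgV1 => /eqP->.
by apply: freeH; rewrite ?groupM ?groupV // permM kx -hx permK.
Qed.

(** By orbit-stabiliser the single orbit has size dividing a prime; it is not a point, since [H] is
    nontrivial, so stabilisers are trivial. *)
Lemma prime_transitive_free H x :
  prime #|H| -> [transitive H, on setT | 'P] ->
  forall h, h \in H -> h x = x -> h = 1.
Proof.
move=> prH trH h hH hx; apply/eqP; have := card_orbit_stab 'P H x.
have ntO : #|orbit 'P H x| != 1%N.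
  rewrite (atransP trH x (in_setT x)) cardsT; apply/negP=> /eqP/fintype1 [y eqy].
  have: H :!=: 1 by rewrite -cardG_gt1 prime_gt1.
  case/trivgPn=> k _ /eqP[]; apply/permP=> z.
  by rewrite (eqy (k z)) perm1 (eqy z).
move=> cardH; have : #|orbit 'P H x| %| #|H| by rewrite -cardH dvdn_mulr.
move/(prime_nt_dvdP prH ntO) => eqO.
move/eqP: cardH; rewrite eqO -[eqbRHS]muln1 eqn_pmul2l ?cardG_gt0 //.
rewrite -trivg_card1 -[_ == 1]subG1 => /subsetP/(_ h).
by rewrite !inE hH sub1set inE /= /aperm hx eqxx => ->.
Qed.

End ClosureTheory.

(** * Subgroups of the square of a group of prime order *)

Section SubdirectPrime.
Variable gT : finGroupType.
Implicit Types (E : {group gT}) (Q : {group gT * gT}).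

Lemma expg_pair (u : gT * gT) k : u ^+ k = (u.1 ^+ k, u.2 ^+ k).
Proof. by case: u => a b; elim: k => // k IHk; rewrite !expgS IHk. Qed.

Lemma prime_order_generates E x :
  prime #|E| -> x \in E -> x != 1 -> <[x]> = E.
Proof.
move=> prE xE ntx; apply/eqP; rewrite eqEsubset cycle_subG xE /=.
apply: prime_meetG => //; rewrite (setIidPr _) ?cycle_subG //.
by rewrite -cycle_eq1 in ntx.
Qed.

(** A Goursat argument on the elements [(1, c)] of [Q]. If one is nontrivial, its powers fill the
    second factor and [x] supplies the first; if none is, [Q] is the graph of an automorphism and is
    generated by [y]. *)
Lemma prime_subdirect E Q x y :
    prime #|E| -> Q \subset setX E E ->
    x \in Q -> x.1 != 1 -> y \in Q -> y.2 != 1 ->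
  Q = setX E E :> {set _} \/ diagonal_subgroup E Q.
Proof.
move=> prE sQE xQ ntx yQ nty.
have QE u : u \in Q -> (u.1 \in E) && (u.2 \in E).
  by move/(subsetP sQE); rewrite inE.
have [/existsP[c /andP[cQ ntc]] | noc] :=
  boolP [exists c, ((1, c) \in Q) && (c != 1)].
  left; apply/eqP; rewrite eqEsubset sQE /=; apply/subsetP=> -[a b].
  rewrite inE /= => /andP[aE bE].
  have /andP[_ /= cE] := QE _ cQ; have /andP[x1E x2E] := QE _ xQ.
  have /cycleP[k defa] : a \in <[x.1]> by rewrite (prime_order_generates prE).
  (* A power of [x] gives the first coordinate [a]; a power of [(1, c)] then corrects the second to
     [b]. *)
  have /cycleP[l defb] : (x.2 ^+ k)^-1 * b \in <[c]>.
    by rewrite (prime_order_generates prE) // groupM // groupV groupX.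
  have -> : (a, b) = x ^+ k * (1, c) ^+ l.
    rewrite !expg_pair /= expg1n -defb; congr (_, _) => /=.
      by rewrite mulg1.
    by rewrite mulKVg.
  by rewrite groupM ?groupX.
right; have /andP[y1E y2E] := QE _ yQ.
have inj2 c : (1, c) \in Q -> c = 1.
  move=> cQ; apply: contraNeq noc => ntc; apply/existsP.
  by exists c; rewrite cQ.
have nty1 : y.1 != 1.
  apply: contraNneq nty => y1; apply/eqP/inj2.
  by rewrite -y1 -surjective_pairing.
have gen1 := prime_order_generates prE y1E nty1.
have gen2 := prime_order_generates prE y2E nty.
(* The automorphism sends [y.1] to [y.2]; it is well defined and injective because both generate
   [E]. *)
have dvd21 : #[y.2] %| #[y.1] by rewrite !orderE gen1 gen2.
have injf : 'injm (eltm dvd21) by rewrite injm_eltm !orderE gen1 gen2.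
have imf : eltm dvd21 @* <[y.1]> = <[y.1]>.
  by rewrite im_eltm gen1 gen2.
exists <[y.1]>%G; split; first by rewrite /= gen1.
exists (aut injf imf); first exact: Aut_aut.
apply/setP=> -[a b]; apply/idP/imsetP=> [abQ | [e]].
  have /andP[/= aE bE] := QE _ abQ.
  have ay : a \in <[y.1]> by rewrite gen1.
  exists a => //; rewrite autE //; have /cycleP[k defa] := ay.
  rewrite defa /= eltmE; congr (_, _).
  (* The first coordinate of this element is trivial, so by [inj2] the second is too. *)
  have : (a, b) * y ^- k \in Q by rewrite groupM ?groupV ?groupX.
  rewrite expg_pair defa => /= H; apply/eqP; rewrite eq_mulgV1; apply/eqP/inj2.
  by congr (_ \in Q): H; congr (_, _) => /=; rewrite mulgV.
case/cycleP=> k -> ->; rewrite autE ?mem_cycle //= eltmE -expg_pair.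
exact: groupX.
Qed.

End SubdirectPrime.

(** * The product action as a homomorphism *)

Section ProductPerm.
Variable D : finType.

Lemma prod_permM : {in setT &, {morph @prod_perm D : u v / u * v}}.
Proof. by move=> u v _ _; apply/permP=> p; rewrite permM !prod_permE /= !permM. Qed.

Canonical prod_perm_morphism := Morphism prod_permM.

End ProductPerm.

(** * Coordinates in the imprimitive wreath product *)

Section WreathTheory.
Variables (D : finType) (s : nat).
Implicit Types (A : {group {perm D}}) (K : {group {perm 'I_s}}).
Implicit Types (x y : {ffun 'I_s -> {perm D}}) (sigma : {perm 'I_s}).
Implicit Types (H : {group {perm D * 'I_s}}) (g h : {perm D * 'I_s}).

Lemma base_permE x w : base_perm x w = (x w.2 w.1, w.2).
Proof. by rewrite permE. Qed.

Lemma top_permE sigma (w : D * 'I_s) : top_perm D sigma w = (w.1, sigma w.2).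
Proof. by rewrite permE. Qed.

Lemma base_permM x y : base_perm x * base_perm y = base_perm [ffun i => x i * y i].
Proof. by apply/permP=> w; rewrite permM !base_permE /= ffunE permM. Qed.

Lemma top_permM sigma tau :
  top_perm D sigma * top_perm D tau = top_perm D (sigma * tau).
Proof. by apply/permP=> w; rewrite permM !top_permE /= permM. Qed.

Lemma base_permJ x sigma :
  base_perm x ^ top_perm D sigma = base_perm [ffun i => x (sigma^-1 i)].
Proof.
apply: (mulgI (top_perm D sigma)); rewrite conjgE mulKVg.
apply/permP=> -[d i]; rewrite !permM !(base_permE, top_permE) /= ffunE.
by rewrite permK.
Qed.

Lemma base_permP (A : {set {perm D}}) g :
  reflect (exists2 x : {ffun 'I_s -> {perm D}}, forall i, x i \in A & g = base_perm x)
          (g \in base s A).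
Proof.
apply: (iffP imsetP) => [[x] | [x xA ->]]; last first.
  by exists x => //; rewrite inE; apply/forallP.
by rewrite inE => /forallP xA ->; exists x.
Qed.

Lemma base_group_set A : group_set (base s A).
Proof.
apply/group_setP; split=> [|_ _ /base_permP[x xA ->] /base_permP[y yA ->]].
  apply/base_permP; exists [ffun=> 1] => [i|]; first by rewrite ffunE group1.
  by apply/permP=> -[d i]; rewrite base_permE ffunE !perm1.
rewrite base_permM; apply/base_permP; exists [ffun i => x i * y i] => // i.
by rewrite ffunE groupM.
Qed.
Canonical base_group A := group (base_group_set A).

Lemma top_group_set K : group_set (top D K).
Proof.
apply/group_setP; split=> [|_ _ /imsetP[u uK ->] /imsetP[v vK ->]].
  by apply/imsetP; exists 1 => //; apply/permP=> -[d i]; rewrite top_permE !perm1.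
by rewrite top_permM imset_f // groupM.
Qed.
Canonical top_group K := group (top_group_set K).

Lemma top_norm_base A K : top D K \subset 'N(base s A).
Proof.
apply/subsetP=> _ /imsetP[u uK ->]; rewrite inE.
apply/subsetP=> _ /imsetP[_ /base_permP[x xA ->] ->].
rewrite base_permJ; apply/base_permP; exists [ffun i => x (u^-1 i)] => // i.
by rewrite ffunE.
Qed.

Lemma wreath_norm_base A K : wreath A K \subset 'N(base s A).
Proof. by rewrite mul_subG ?normG ?top_norm_base. Qed.

Lemma sdprod_wreath A K : base s A ><| top D K = wreath A K.
Proof.
apply: sdprodE; first exact: top_norm_base.
apply/trivgP/subsetP=> g; rewrite !inE => /andP[/base_permP[x _ ->] /imsetP[u _ eqxu]].
(* A base element keeps the block index and a top element keeps the point of [D], so a common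
   element fixes both. *)
apply/eqP/permP=> -[d i]; move/permP/(_ (d, i)): (eqxu).
by rewrite {2}eqxu base_permE !top_permE perm1 /= => -[_ <-].
Qed.

Lemma wreathP (A : {set {perm D}}) (K : {set {perm 'I_s}}) g :
  reflect (exists (x : {ffun 'I_s -> {perm D}}) sigma,
                  [/\ forall i, x i \in A, sigma \in K
                    & g = base_perm x * top_perm D sigma])
          (g \in wreath A K).
Proof.
apply: (iffP mulsgP) => [[_ _ /base_permP[x xA ->] /imsetP[u uK ->] ->] |].
  by exists x, u.
case=> x [u [xA uK ->]].
exists (base_perm x) (top_perm D u) => //; last exact: imset_f.
by apply/base_permP; exists x.
Qed.

Lemma wreath_of_blockwise g sigma :
  (forall w, (g w).2 = sigma w.2) -> exists x, g = base_perm x * top_perm D sigma.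
Proof.
move=> gs; have inj i : injective (fun d => (g (d, i)).1).
  move=> d e /= eq1; suff /perm_inj[] : g (d, i) = g (e, i) by [].
  by apply/eqP; rewrite -pair_eqE /= /pair_eq eq1 !gs !eqxx.
exists [ffun i => perm (inj i)]; apply/permP=> -[d i].
by rewrite wreath_permE ffunE permE [LHS]surjective_pairing gs.
Qed.

Lemma block_stabP (H : {set {perm D * 'I_s}}) i h :
  reflect (h \in H /\ forall d, (h (d, i)).2 = i) (h \in block_stab H i).
Proof.
rewrite /block_stab in_setI; apply: (iffP andP) => -[hH hi]; split=> //.
  by move=> d; have := astabs_act (d, i) hi; rewrite !inE eqxx => /eqP.
rewrite !inE /=; apply/subsetP=> -[d j]; rewrite !inE /= => /eqP->.
by rewrite hi.
Qed.

Lemma induced_on_blockP (H : {set {perm D * 'I_s}}) i (r : {perm D}) :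
  reflect (exists2 h, h \in H & forall d, h (d, i) = (r d, i))
          (r \in induced_on_block H i).
Proof.
rewrite inE; apply: (iffP exists_inP) => -[h hH hr]; exists h.
- by case/block_stabP: hH.
- by move=> d; apply/eqP/(forallP hr).
- by apply/block_stabP; split=> // d; rewrite hr.
- by apply/forallP=> d; rewrite hr.
Qed.

Lemma induced_on_blocksP (H : {set {perm D * 'I_s}}) sigma :
  reflect (exists2 h, h \in H & forall w, (h w).2 = sigma w.2)
          (sigma \in induced_on_blocks H).
Proof.
rewrite inE; apply: (iffP exists_inP) => -[h hH hs]; exists h => //.
  move=> [d i]; have /eqP/setP/(_ (h (d, i))) := forallP hs i.
  by rewrite imset_f ?inE //= => /esym/eqP.
apply/forallP=> i; apply/eqP/setP=> w; apply/imsetP/idP=> [[v] | ].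
  by rewrite !inE => /eqP <- ->; rewrite hs.
rewrite inE => /eqP wi; exists (h^-1 w); last by rewrite permKV.
by rewrite inE -(inj_eq (@perm_inj _ sigma)) -hs permKV wi.
Qed.

(** Containment in the wreath product keeps [wr_coord] away from its default value, so [rho] can be
    read off from the action on the two blocks. *)
Lemma rhoP (A : {set {perm D}}) (K : {set {perm 'I_s}}) H i j
    (u : {perm D} * {perm D}) : H \subset wreath A K ->
  reflect (exists2 h, h \in H & (forall d, h (d, i) = (u.1 d, i)) /\
                                (forall d, h (d, j) = (u.2 d, j)))
          (u \in rho i j @: (block_stab H i :&: block_stab H j)).
Proof.
move/subsetP=> sHW; apply: (iffP imsetP) => [[h] | [h hH [hi hj]]].
  case/setIP=> /block_stabP[hH hi] /block_stabP[_ hj] ->; exists h => //.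
  have /wreathP[x [t [_ _ defh]]] := sHW h hH.
  move: hi hj; rewrite /rho defh wr_coordE => hi hj.
  by split=> d; [move: (hi d) | move: (hj d)]; rewrite wreath_permE /= => ->.
exists h.
  by apply/setIP; split; apply/block_stabP; split=> // d; rewrite ?hi ?hj.
have /wreathP[x [t [_ _ defh]]] := sHW h hH.
case: u hi hj => a b /=; rewrite /rho defh wr_coordE => hi hj.
by congr (_, _); apply/permP=> d; [move: (hi d) | move: (hj d)];
  rewrite wreath_permE /= => -[->].
Qed.

Lemma rho_group_set (A : {set {perm D}}) (K : {set {perm 'I_s}}) H i j :
  H \subset wreath A K ->
  group_set (rho i j @: (block_stab H i :&: block_stab H j)).
Proof.
move=> sHW; apply/group_setP; split=> [|u v].
  by apply/(rhoP _ _ _ sHW); exists 1 => //; split=> d; rewrite !perm1.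
move=> /(rhoP _ _ _ sHW)[g gH [gi gj]] /(rhoP _ _ _ sHW)[h hH [hi hj]].
apply/(rhoP _ _ _ sHW); exists (g * h); first exact: groupM.
by split=> d; rewrite !permM ?gi ?gj ?hi ?hj.
Qed.

End WreathTheory.

(** * Moving between blocks *)

Section TwoClosureOfImprimitive.
Variables (D : finType) (n : nat) (G : {group {perm D * 'I_n.+1}}) (d0 : D).
Implicit Types (x y : {ffun 'I_n.+1 -> {perm D}}) (i j : 'I_n.+1).
Implicit Types (H : {group {perm D * 'I_n.+1}}).

Local Notation L := (induced_on_blocks G).
Local Notation R := (induced_on_block G ord0).
Local Notation X := (closure2 G).
Local Notation Y := (induced_on_block X ord0).
Local Notation N := (base n.+1 Y :&: X).
Local Notation Q i j := (rho i j @: (block_stab G i :&: block_stab G j)).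
Local Notation P i j := (prod_perm (T := D) @: Q i j).

Hypothesis trG : [transitive G, on setT | 'P].
Hypothesis sGW : G \subset wreath R L.

Lemma block_move i j :
  exists (x : {ffun 'I_n.+1 -> {perm D}}) (sigma : {perm 'I_n.+1}),
  [/\ forall k, x k \in R, sigma i = j & base_perm x * top_perm D sigma \in G].
Proof.
have [g gG gij] := atransP2 trG (in_setT (d0, i)) (in_setT (d0, j)).
have /wreathP[x [t [xR _ defg]]] := subsetP sGW g gG.
exists x, t; split=> //; last by rewrite -defg.
by move: gij; rewrite /= /aperm defg wreath_permE => -[_ ->].
Qed.

Lemma induced_on_block_transitive : [transitive R, on setT | 'P].
Proof.
apply/imsetP; exists d0 => //; apply/esym/eqP; rewrite -subTset.
apply/subsetP=> e _; have := atransP2 trG (in_setT (d0, ord0)) (in_setT (e, ord0)).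
case=> g gG /esym; rewrite /= /aperm => ge.
have /wreathP[x [t [xR _ defg]]] := subsetP sGW g gG.
move: ge; rewrite defg wreath_permE => -[xe _].
by apply/orbitP; exists (x ord0).
Qed.

Lemma induced_on_blockS H : G \subset H -> R \subset induced_on_block H ord0.
Proof.
move=> sGH; apply/subsetP=> r /induced_on_blockP[h hG hr].
by apply/induced_on_blockP; exists h => //; apply: (subsetP sGH).
Qed.

(* Composing with elements of [G] that move block [ord0] to block [i], and
   block [sigma i] back to [ord0], changes [x i] only by factors in [R]. *)
Lemma coordinate_induced H x sigma i :
  G \subset H -> base_perm x * top_perm D sigma \in H ->
  x i \in induced_on_block H ord0.
Proof.
move=> sGH gH; have /subsetP sRH := induced_on_blockS sGH.
have [a [u [/(_ _)/sRH aR u0 aG]]] := block_move ord0 i.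
have [b [v [/(_ _)/sRH bR v0 bG]]] := block_move (sigma i) ord0.
rewrite -(groupMl _ (aR ord0)) -(groupMr _ (bR (sigma i))).
apply/induced_on_blockP.
exists (base_perm a * top_perm D u * (base_perm x * top_perm D sigma)
          * (base_perm b * top_perm D v)).
  by apply: groupM (subsetP sGH _ bG); apply: groupM gH; apply: (subsetP sGH).
by move=> d; rewrite permM (permM _ _ (d, _)) !wreath_permE /= u0 v0 !permM.
Qed.

(** [R] is defined on block [ord0]; conjugating by an element of [G] that takes this block to block
    [i] realises it there. *)
Lemma induced_on_block_all r i :
  r \in R -> exists2 h, h \in G & forall d, h (d, i) = (r d, i).
Proof.
move=> rR; have [a [u [aR u0 aG]]] := block_move ord0 i.
have /induced_on_blockP[h hG hr] : r ^ (a ord0)^-1 \in R.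
  by apply: groupJ => //; rewrite groupV; apply: aR.
exists (h ^ (base_perm a * top_perm D u)); first exact: groupJ.
move=> d; have -> : (d, i) = (base_perm a * top_perm D u) ((a ord0)^-1 d, ord0).
  by rewrite wreath_permE /= permKV u0.
by rewrite permJ hr wreath_permE /= u0 conjgE invgK !permM permKV permKV.
Qed.

(** * Bounds on the 2-closure *)

Lemma sub_induced_closure2 : R \subset Y.
Proof. exact/induced_on_blockS/sub_closure2. Qed.

Lemma induced_closure2_sub : Y \subset closure2 R.
Proof.
apply/subsetP=> r /induced_on_blockP[g /closure2P agree gr].
apply/closure2P=> a b.
have [h hG []] := agree (a, ord0) (b, ord0); rewrite !gr.
have /wreathP[x [t [xR _ ->]]] := subsetP sGW h hG; rewrite !wreath_permE /=.
by move=> [xa _] [xb _]; exists (x ord0).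
Qed.

(** Interpolating at two points of one block shows that the block of the image depends only on the
    block of the point. Interpolating at two blocks, probed through [d0], shows that the index map
    is injective and agrees with [L] on pairs. *)
Lemma closure2_blockwise g : g \in X ->
  exists2 sigma, sigma \in closure2 L & forall w, (g w).2 = sigma w.2.
Proof.
move=> /closure2P agree.
have agree2 a b : exists2 t, t \in L & t a.2 = (g a).2 /\ t b.2 = (g b).2.
  have [h hG [<- <-]] := agree a b.
  have /wreathP[x [t [_ tL ->]]] := subsetP sGW h hG.
  by exists t => //; rewrite !wreath_permE.
have injf : injective (fun i => (g (d0, i)).2).
  move=> i j /= eqg; have [t _ /= []] := agree2 (d0, i) (d0, j).
  by rewrite eqg => <- /perm_inj.
exists (perm injf).
  apply/closure2P=> i j; have [t tL /= [ti tj]] := agree2 (d0, i) (d0, j).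
  by exists t; rewrite ?permE.
by move=> w; rewrite permE; have [t _ /= [<- <-]] := agree2 w (d0, w.2).
Qed.

Hypothesis defL : L = closure2 L.

Lemma closure2_sub_wreath : X \subset wreath Y L.
Proof.
apply/subsetP=> g gX; have [t] := closure2_blockwise gX; rewrite -defL => tL gt.
have [x defg] := wreath_of_blockwise gt; apply/wreathP; exists x, t; split=> // i.
rewrite defg in gX.
exact: (coordinate_induced (H := closure2_group G) i (sub_closure2 G) gX).
Qed.

Lemma closure2_norm_base : X \subset 'N(base n.+1 Y).
Proof. exact: subset_trans closure2_sub_wreath (wreath_norm_base _ _). Qed.

Lemma norm_base_closure2 : G \subset 'N(N).
Proof.
rewrite normsI ?(subset_trans (sub_closure2 G) closure2_norm_base) //.
exact: subset_trans (sub_closure2 G) (normG _).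
Qed.

(** * The normal complement [N] of [G] *)

Hypothesis coreG : gcore (block_stab G ord0) G = 1.

Lemma sdprod_closure2 : N ><| G = X.
Proof.
rewrite sdprodE ?norm_base_closure2 //.
  apply/eqP; rewrite eqEsubset mul_subG ?subsetIr ?sub_closure2 //=.
  apply/subsetP=> g gX.
  have /wreathP[x [t [xY tL defg]]] := subsetP closure2_sub_wreath g gX.
  have /induced_on_blocksP[h hG ht] := tL.
  have [y defh] := wreath_of_blockwise ht.
  have hX := subsetP (sub_closure2 G) h hG.
  (* Since [h] acts on the blocks as [g] does, [g * h^-1] lies in the base group. *)
  rewrite -(mulgKV h g); apply: mem_mulg => //; apply/setIP; split; last first.
    by apply: groupM => //; rewrite groupV; apply: hX.
  (* Nothing is known yet about the entries of [y]; by uniqueness of coordinates they are those of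
     [z], which lie in [R]. *)
  have /wreathP[z [t' [zR _]]] := subsetP sGW h hG.
  rewrite defh => /(congr1 (@wr_coord _ _)); rewrite !wr_coordE => eqyz.
  rewrite defg invMg mulgA mulgK; apply: groupM; first by apply/base_permP; exists x.
  rewrite groupV; apply/base_permP; exists y => // i.
  by rewrite eqyz (subsetP sub_induced_closure2).
(* [N :&: G] is normalised by [G] and fixes every block, so it lies in the core. *)
apply/trivgP; rewrite -coreG; apply: gcore_max; last first.
  by apply: normsI (normG _); apply: norm_base_closure2.
apply/subsetP=> g /setIP[/setIP[/base_permP[x _ defg] _] gG].
by apply/block_stabP; split=> // d; rewrite defg base_permE.
Qed.

Lemma base_closure2_nontrivial : G != X :> {set _} -> N != 1.
Proof.
apply: contraNneq => N1; have := sdprod_closure2; rewrite N1 sdprod1g => <-.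
exact: eqxx.
Qed.

Lemma prod_perm_rho_group i j : exists H : {group {perm D * D}}, P i j = H.
Proof.
exists [group of prod_perm_morphism D @* group (rho_group_set i j sGW)].
by rewrite /= morphimEsub ?subsetT.
Qed.

(** An element of [G] agreeing with [base_perm y] at points of blocks [i] and [j] fixes both blocks.
    Interpolation across distinct blocks is therefore the 1-closure condition for the image of
    [rho i j]. *)
Lemma base_closure2E :
  N = [set base_perm y | y : {ffun 'I_n.+1 -> {perm D}} &
         [forall i, y i \in Y] &&
         [forall i : 'I_n.+1, forall j : 'I_n.+1, (i < j) ==>
            (prod_perm (y i, y j) \in closure1 (P i j))]].
Proof.
apply/setP=> g; rewrite inE; apply/andP/imsetP=> [[/base_permP[y yY ->] yX] | [y]].
  exists y => //; rewrite inE; apply/andP; split; apply/forallP=> // i.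
  apply/forallP=> j; apply/implyP=> _; have [H PE] := prod_perm_rho_group i j.
  rewrite PE; apply/closure1P=> -[d e].
  move/closure2P: yX => /(_ (d, i) (e, j)) [h hG].
  rewrite !base_permE /=; have /wreathP[x [t [_ _ defh]]] := subsetP sGW h hG.
  rewrite defh !wreath_permE /= => -[[xd ti] [xe tj]].
  apply/orbitP; exists (prod_perm (x i, x j)); last first.
    by rewrite /= /aperm !prod_permE /= xd xe.
  rewrite -PE imset_f //; apply/(rhoP _ _ _ sGW); exists h => //.
  by rewrite defh; split=> a; rewrite wreath_permE /= ?ti ?tj.
rewrite inE => /andP[/forallP yY /forallP yP] ->.
split; first by apply/base_permP; exists y.
have agree i j (d e : D) : i < j -> exists2 h, h \in G &
    h (d, i) = base_perm y (d, i) /\ h (e, j) = base_perm y (e, j).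
  move=> lt_ij; have /implyP/(_ lt_ij) := forallP (yP i) j.
  have [H PE] := prod_perm_rho_group i j.
  rewrite PE => /closure1P/(_ (d, e))/orbitP[u]; rewrite -PE => /imsetP[v vQ ->].
  rewrite /= /aperm !prod_permE !base_permE /= => -[vd ve].
  have [h hG [hi hj]] := rhoP _ _ _ sGW vQ; exists h => //.
  by rewrite hi hj vd ve.
apply/closure2P=> -[d i] [e j]; have [lt_ij | lt_ji | /val_inj <-] := ltngtP i j.
- exact: agree.
- by have [h hG [he hd]] := agree j i e d lt_ji; exists h.
(* For two points of one block, [y i] lies in the 2-closure of [R], and the interpolating [r] lifts
   to [G] on block [i]. *)
have /closure2P/(_ d e)[r rR [rd re]] := subsetP induced_closure2_sub _ (yY i).
have [h hG hr] := induced_on_block_all i rR; exists h => //.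
by rewrite !hr !base_permE /= rd re.
Qed.

(** * Blocks with induced group of prime order *)

Hypothesis prR : prime #|R|.

Lemma induced_free d r : r \in R -> r d = d -> r = 1.
Proof.
move=> rR; apply: prime_transitive_free rR => //.
exact: induced_on_block_transitive.
Qed.

Lemma induced_eq d r t : r \in R -> t \in R -> r d = t d -> r = t.
Proof.
move=> rR tR eq_d; apply/eqP; rewrite eq_mulgV1; apply/eqP/(@induced_free d).
  by rewrite groupM ?groupV.
by rewrite permM eq_d permK.
Qed.

Lemma closure2_induced_prime : closure2 R = R.
Proof. exact: (closure2_free_point (x := d0) (@induced_free d0)). Qed.

Lemma induced_closure2_prime : Y = R.
Proof.
apply/eqP; rewrite eqEsubset sub_induced_closure2 andbT.
by have := induced_closure2_sub; rewrite closure2_induced_prime.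
Qed.

Lemma rho_sub i j : Q i j \subset setX R R.
Proof.
apply/subsetP=> _ /imsetP[h /setIP[/block_stabP[hG _] _] ->].
have /wreathP[x [t [xR _ ->]]] := subsetP sGW h hG.
by rewrite inE /rho wr_coordE /= !xR.
Qed.

(** By regularity a pair in [setX R R] is determined by its image of [(d0, d0)]. For a pair in the
    1-closure, that image is already attained by an element of [Q i j]. *)
Lemma rho_closed i j :
  P i j = (prod_perm (T := D) @: setX R R) :&: closure1 (P i j).
Proof.
have [H PE] := prod_perm_rho_group i j.
apply/eqP; rewrite eqEsubset subsetI imsetS ?rho_sub //= {1}PE.
rewrite closure1_max //=; last by rewrite PE.
apply/subsetP=> _ /setIP[/imsetP[[a b] /setXP[/= aR bR] ->]].
rewrite {1}PE => /closure1P/(_ (d0, d0))/orbitP[u]; rewrite -PE.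
case/imsetP=> -[a' b'] abQ ->; have := subsetP (rho_sub i j) _ abQ.
rewrite /= /aperm !prod_permE inE /= => /andP[aR' bR'] [ea eb].
by rewrite -(induced_eq aR' aR ea) -(induced_eq bR' bR eb) imset_f.
Qed.

Lemma base_closure2_rho y i j : base_perm y \in N -> (y i, y j) \in Q i j.
Proof.
case/setIP=> /base_permP[z zY eqyz] /closure2P/(_ (d0, i) (d0, j))[h hG].
have {z zY eqyz} yR k : y k \in R.
  suff -> : y = z by rewrite -induced_closure2_prime.
  by rewrite -(wr_coordE y 1) -(wr_coordE z 1) eqyz.
have /wreathP[x [t [xR _ defh]]] := subsetP sGW h hG.
rewrite defh !wreath_permE !base_permE /= => -[[xi ti] [xj tj]].
apply/(rhoP _ _ _ sGW); exists h => //=.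
rewrite -(induced_eq (xR i) (yR i) xi) -(induced_eq (xR j) (yR j) xj) defh.
by split=> d; rewrite wreath_permE /= ?ti ?tj.
Qed.

Lemma base_closure2_moves i : N != 1 ->
  exists2 y, base_perm y \in N & y i != 1.
Proof.
case/trivgPn=> g gN; have /setIP[/base_permP[z _ defg] _] := gN.
rewrite defg => ntz; have [k ntk] : exists k, z k != 1.
  apply/existsP; apply: contraNT ntz; rewrite negb_exists => /forallP z1.
  apply/eqP/permP=> -[d k]; rewrite base_permE perm1 /=.
  by have /negPn/eqP-> := z1 k; rewrite perm1.
(* Conjugating by an element of [G] that takes block [k] to block [i] preserves [N] and carries the
   nontrivial coordinate from [k] to [i]. *)
have [a [u [_ uk aG]]] := block_move k i; set b := _ * _ in aG.
have gbN : g ^ b \in N by rewrite memJ_norm // (subsetP norm_base_closure2).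
have /setIP[/base_permP[y _ defgb] _] := gbN.
exists y; first by rewrite -defgb.
apply: contraNneq ntk => y1; apply/eqP/permP=> d.
have := permJ g b (d, k); rewrite defgb defg wreath_permE !base_permE /= uk y1 perm1.
by rewrite wreath_permE uk perm1 /= => -[/perm_inj].
Qed.

Lemma base_closure2_moves2 i j : N != 1 ->
  exists y, [/\ base_perm y \in N, y i != 1 & y j != 1].
Proof.
move=> ntN; have [y yN nty] := base_closure2_moves i ntN.
have [z zN ntz] := base_closure2_moves j ntN.
have [yj | ] := eqVneq (y j) 1; last by exists y.
have [zi | ] := eqVneq (z i) 1; last by exists z.
(* Here [y] is trivial at [j] and [z] at [i], so the product has coordinates [y i] and [z j]
   there. *)
exists [ffun k => y k * z k]; rewrite -base_permM !ffunE yj zi mulg1 mul1g.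
by split=> //; apply: groupM.
Qed.

Lemma rho_prime i j : N != 1 -> Q i j = setX R R \/ diagonal_subgroup R (Q i j).
Proof.
move=> ntN; have [y [yN yi yj]] := base_closure2_moves2 i j ntN.
have yQ := base_closure2_rho i j yN.
exact: (prime_subdirect (Q := group (rho_group_set i j sGW)) prR (rho_sub i j)
          yQ yi yQ yj).
Qed.

End TwoClosureOfImprimitive.

Theorem lemma3p5 (D : finType) (n : nat) (G : {group {perm D * 'I_n.+1}}) :
  let L := induced_on_blocks G in
  let M (i : 'I_n.+1) := block_stab G i in
  let R := induced_on_block G ord0 in
  let X := closure2 G in
  let Y := induced_on_block X ord0 in
  let N := base n.+1 Y :&: X in
  let P (i j : 'I_n.+1) := prod_perm (T := D) @: (rho i j @: (M i :&: M j)) in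
  [transitive G, on setT | 'P] ->
  imprimitivity_system G setT 'P (blocks D n.+1) ->
  gcore (M ord0) G = 1 ->
  G \subset wreath R L ->
  G != X :> {set _} ->
  L = closure2 L ->
  [/\ (* (a) *)
      [/\ X \subset wreath Y L,
          base n.+1 Y ><| top D L = wreath Y L,
          R \subset Y
        & Y \subset closure2 R],
      (* (b) *)
      [/\ N ><| G = X,
          N != 1
        & N = [set base_perm y | y : {ffun 'I_n.+1 -> {perm D}} &
                 [forall i, y i \in Y] &&
                 [forall i : 'I_n.+1, forall j : 'I_n.+1, (i < j) ==>
                    (prod_perm (y i, y j) \in closure1 (P i j))]]]
    & (* (c) *)
      prime #|R| ->
      [/\ Y = closure2 R,
          closure2 R = R,
          cyclic R
        & forall j : 'I_n.+1, 0 < j ->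
          [/\ P ord0 j =
                (prod_perm (T := D) @: setX Y Y) :&: closure1 (P ord0 j),
              P ord0 j = prod_perm (T := D) @: setX Y Y \/
                (exists2 Q, diagonal_subgroup Y Q
                          & P ord0 j = prod_perm (T := D) @: Q)
            & exists y : {ffun 'I_n.+1 -> {perm D}},
                [/\ base_perm y \in N, y ord0 != 1 & y j != 1]]]].
Proof.
move=> L M R X Y N P trG imp coreG sGW neqGX defL.
(* There are fewer blocks than points, so a point exists; it provides the base point [d0] of [D]. *)
have [[d0 i0] _] : exists w : D * 'I_n.+1, w \in setT.
  apply/set0Pn; rewrite -card_gt0; case/and3P: imp => _ _ /andP[_].
  exact: leq_ltn_trans.
have ntN : N != 1 by apply: base_closure2_nontrivial.
split.
- split; first exact: closure2_sub_wreath.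
  + exact: sdprod_wreath.
  + exact: sub_induced_closure2.
  + exact: induced_closure2_sub.
- split=> //; first exact: sdprod_closure2.
  exact: base_closure2E.
move=> prR; have cR := closure2_induced_prime d0 trG sGW prR.
have eqYR : Y = R by apply: induced_closure2_prime.
split=> [|||j _]; rewrite ?cR ?eqYR //; first exact: prime_cyclic.
split; first exact: rho_closed.
  have [eqQ | diagQ] := rho_prime d0 trG sGW defL prR ord0 j ntN.
    by left; rewrite /P eqQ.
  by right; exists (rho ord0 j @: (M ord0 :&: M j)).
exact: base_closure2_moves2.
Qed.
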